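(* The mix rule $$\frac{\Delta\vdash\phi\qquad \Gamma[\phi]\cdots[\phi]\vdash\psi}{\Gamma[\Delta]\cdots[\Delta]\vdash\psi}\ (\mathrm{mix})$$ is admissible in the sequent calculus $\mathsf{G_{BDFNL}}$: if both premisses are derivable in $\mathsf{G_{BDFNL}}$, then so is the conclusion. Here $\Gamma[-]\cdots[-]$ is a context with one or more holes, and $\Gamma[\Delta]\cdots[\Delta]$ results from replacing the displayed occurrences of $\phi$ by $\Delta$.
   Context: $\mathcal{L}_{\mathrm{LC}}$-formulas are built from propositional variables and $\top,\bot$ using $\wedge,\vee,\to,\bullet,\leftarrow$. Structures: $\Gamma::=\phi\mid(\Gamma\odot\Gamma)\mid(\Gamma\barwedge\Gamma)$ with $\phi$ an $\mathcal{L}_{\mathrm{LC}}$-formula; $\odot$ and $\barwedge$ are structural operators for $\bullet$ and $\wedge$. A consecution is $\Gamma\vdash\phi$ with $\Gamma$ a structure and $\phi$ an $\mathcal{L}_{\mathrm{LC}}$-formula. A context $\Gamma[-]$ is a structure with a hole, and $\Gamma[\Delta]$ is the result of filling the hole with the structure $\Delta$ (similarly for contexts with several holes). $\mathsf{G_{BDFNL}}$ has: Axioms: $\phi\vdash\phi$; $\Gamma\vdash\top$; $\Gamma[\bot]\vdash\phi$. Logical rules: from $\Delta\vdash\phi$ and $\Gamma[\psi]\vdash\gamma$ infer $\Gamma[\Delta\odot(\phi\to\psi)]\vdash\gamma$; from $\phi\odot\Gamma\vdash\psi$ infer $\Gamma\vdash\phi\to\psi$; from $\Gamma[\phi]\vdash\gamma$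 and $\Delta\vdash\psi$ infer $\Gamma[(\phi\leftarrow\psi)\odot\Delta]\vdash\gamma$; from $\Gamma\odot\psi\vdash\phi$ infer $\Gamma\vdash\phi\leftarrow\psi$; from $\Gamma[\phi\odot\psi]\vdash\gamma$ infer $\Gamma[\phi\bullet\psi]\vdash\gamma$; from $\Gamma\vdash\phi$ and $\Delta\vdash\psi$ infer $\Gamma\odot\Delta\vdash\phi\bullet\psi$; from $\Gamma[\phi\barwedge\psi]\vdash\gamma$ infer $\Gamma[\phi\wedge\psi]\vdash\gamma$; from $\Gamma\vdash\phi$ and $\Delta\vdash\psi$ infer $\Gamma\barwedge\Delta\vdash\phi\wedge\psi$; from $\Gamma[\phi]\vdash\gamma$ and $\Gamma[\psi]\vdash\gamma$ infer $\Gamma[\phi\vee\psi]\vdash\gamma$; from $\Gamma\vdash\phi_i$ infer $\Gamma\vdash\phi_1\vee\phi_2$ ($i=1,2$). Structural rules: from $\Gamma[\Delta\barwedge\Delta]\vdash\phi$ infer $\Gamma[\Delta]\vdash\phi$; from $\Gamma[\Delta]\vdash\phi$ infer $\Gamma[\Sigma\barwedge\Delta]\vdash\phi$; from $\Gamma[\Delta\barwedge\Lambda]\vdash\phi$ infer $\Gamma[\Lambda\barwedge\Delta]\vdash\phi$; from $\Gamma[(\Delta_1\barwedge\Delta_2)\barwedge\Delta_3]\vdash\phi$ infer $\Gamma[\Delta_1\barwedge(\Delta_2\barwedge\Delta_3)]\vdash\phi$. *)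

(* Defs.v *)
Set Implicit Arguments.
Unset Strict Implicit.
Unset Printing Implicit Defensive.

(* [V] is the set of propositional variables.
   [LDiv phi psi] is phi -> psi and [RDiv phi psi] is phi <- psi; with respect
   to the product, [LDiv] takes its argument phi on the left and [RDiv] takes
   its argument psi on the right. *)
Inductive form (V : Type) : Type :=
| Var (p : V)
| Top
| Bot
| And (phi psi : form V)
| Or (phi psi : form V)
| LDiv (phi psi : form V)
| Prod (phi psi : form V)
| RDiv (phi psi : form V).

Arguments Top {V}.
Arguments Bot {V}.

(* [SProd] is the structural operator of the product, [SAnd] that of the
   conjunction.  There is no empty structure. *)
Inductive struct (V : Type) : Type :=
| SForm (phi : form V)
| SProd (G D : struct V)
| SAnd (G D : struct V).

Declare Scope form_scope.
Delimit Scope form_scope with form.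
Bind Scope form_scope with form.
Declare Scope struct_scope.
Delimit Scope struct_scope with struct.
Bind Scope struct_scope with struct.

Notation "A ∧ B" := (And A B) (at level 40, left associativity) : form_scope.
Notation "A ∨ B" := (Or A B) (at level 50, left associativity) : form_scope.
Notation "A • B" := (Prod A B) (at level 40, left associativity) : form_scope.
Notation "A → B" := (LDiv A B) (at level 55, right associativity) : form_scope.
Notation "A ← B" := (RDiv A B) (at level 56, left associativity) : form_scope.
Notation "⟨ A ⟩" := (SForm A) (at level 0, A at level 99) : struct_scope.
Notation "G ⊙ D" := (SProd G D) (at level 40, left associativity) : struct_scope.
Notation "G ⊼ D" := (SAnd G D) (at level 40, left associativity) : struct_scope.

(* Structures with exactly one hole. *)
Inductive ctx (V : Type) : Type :=
| Hole
| CProdL (G : ctx V) (D : struct V)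
| CProdR (D : struct V) (G : ctx V)
| CAndL (G : ctx V) (D : struct V)
| CAndR (D : struct V) (G : ctx V).

Arguments Hole {V}.

Fixpoint fill (V : Type) (G : ctx V) (X : struct V) : struct V :=
  match G with
  | Hole => X
  | CProdL G' D => SProd (fill G' X) D
  | CProdR D G' => SProd D (fill G' X)
  | CAndL G' D => SAnd (fill G' X) D
  | CAndR D G' => SAnd D (fill G' X)
  end.

(* Structures with any finite number of holes, possibly none. *)
Inductive mctx (V : Type) : Type :=
| MHole
| MForm (phi : form V)
| MProd (G D : mctx V)
| MAnd (G D : mctx V).

Arguments MHole {V}.

Fixpoint holes (V : Type) (G : mctx V) : nat :=
  match G with
  | MHole => 1
  | MForm _ => 0
  | MProd G1 G2 => holes G1 + holes G2
  | MAnd G1 G2 => holes G1 + holes G2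
  end.

(* The same structure [X] is put in every hole. *)
Fixpoint mfill (V : Type) (G : mctx V) (X : struct V) : struct V :=
  match G with
  | MHole => X
  | MForm phi => SForm phi
  | MProd G1 G2 => SProd (mfill G1 X) (mfill G2 X)
  | MAnd G1 G2 => SAnd (mfill G1 X) (mfill G2 X)
  end.

Notation "G ⟦ X ⟧" := (fill G X%struct)
  (at level 9, X at level 99, format "G ⟦ X ⟧") : struct_scope.

Reserved Notation "G ⊢ phi" (at level 70, no associativity).

(* [G ⊢ phi] : the consecution is derivable in G_BDFNL (which has no cut rule). *)
Inductive derivable (V : Type) : struct V -> form V -> Prop :=
| d_id phi :
    ⟨phi⟩ ⊢ phi
| d_top G :
    G ⊢ Top
| d_bot (G : ctx V) phi :
    G⟦⟨Bot⟩⟧ ⊢ phi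
| d_ldivL (G : ctx V) D phi psi gamma :
    D ⊢ phi -> G⟦⟨psi⟩⟧ ⊢ gamma -> G⟦D ⊙ ⟨phi → psi⟩⟧ ⊢ gamma
| d_ldivR G phi psi :
    ⟨phi⟩ ⊙ G ⊢ psi -> G ⊢ phi → psi
| d_rdivL (G : ctx V) D phi psi gamma :
    G⟦⟨phi⟩⟧ ⊢ gamma -> D ⊢ psi -> G⟦⟨phi ← psi⟩ ⊙ D⟧ ⊢ gamma
| d_rdivR G phi psi :
    G ⊙ ⟨psi⟩ ⊢ phi -> G ⊢ phi ← psi
| d_prodL (G : ctx V) phi psi gamma :
    G⟦⟨phi⟩ ⊙ ⟨psi⟩⟧ ⊢ gamma -> G⟦⟨phi • psi⟩⟧ ⊢ gamma
| d_prodR G D phi psi :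
    G ⊢ phi -> D ⊢ psi -> G ⊙ D ⊢ phi • psi
| d_andL (G : ctx V) phi psi gamma :
    G⟦⟨phi⟩ ⊼ ⟨psi⟩⟧ ⊢ gamma -> G⟦⟨phi ∧ psi⟩⟧ ⊢ gamma
| d_andR G D phi psi :
    G ⊢ phi -> D ⊢ psi -> G ⊼ D ⊢ phi ∧ psi
| d_orL (G : ctx V) phi psi gamma :
    G⟦⟨phi⟩⟧ ⊢ gamma -> G⟦⟨psi⟩⟧ ⊢ gamma -> G⟦⟨phi ∨ psi⟩⟧ ⊢ gamma
| d_orR1 G phi1 phi2 :
    G ⊢ phi1 -> G ⊢ phi1 ∨ phi2
| d_orR2 G phi1 phi2 :
    G ⊢ phi2 -> G ⊢ phi1 ∨ phi2
| d_contr (G : ctx V) D phi :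
    G⟦D ⊼ D⟧ ⊢ phi -> G⟦D⟧ ⊢ phi
| d_weak (G : ctx V) S D phi :
    G⟦D⟧ ⊢ phi -> G⟦S ⊼ D⟧ ⊢ phi
| d_comm (G : ctx V) D L phi :
    G⟦D ⊼ L⟧ ⊢ phi -> G⟦L ⊼ D⟧ ⊢ phi
| d_assoc (G : ctx V) D1 D2 D3 phi :
    G⟦(D1 ⊼ D2) ⊼ D3⟧ ⊢ phi -> G⟦D1 ⊼ (D2 ⊼ D3)⟧ ⊢ phi
where "G ⊢ phi" := (derivable G%struct phi%form) : type_scope.

(* Main.v *)
Require Import Defs.

(** The mix formula [phi] is eliminated by induction on [phi], with two nested
    inductions on derivations that are each structural, so that no height or
    rank is needed.

    For a fixed derivation of [D ⊢ phi], the mix is permuted upwards in the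
    derivation of the right premiss ([mix_step]).  Any set of occurrences of
    [phi] may be replaced by [D] ([repl]), so contraction, which duplicates
    occurrences of [phi], commutes with the mix like every other rule.  The mix
    is stuck only where a replaced occurrence of [phi] is principal in a left
    rule: then the required consecution has the form [G⟦D⟧ ⊢ gamma], where
    [G⟦⟨phi⟩⟧ ⊢ gamma] is derivable by the same left rule with the other selected
    occurrences of [phi] already replaced.

    There the mix is a cut on a single occurrence, and it is permuted upwards
    in the derivation of [D ⊢ phi] ([cut_reduction]): every left or structural
    rule acts inside [D] and so may be applied inside [G⟦D⟧].  What remains is
    the case where [D ⊢ phi] comes from the right rule of [phi], and this is
    handled by cuts on the immediate subformulas of [phi]. *)

Set Implicit Arguments.

(** * Contexts and replacement of occurrences *)

(** Composition: [C] is put in the hole of [G]. *)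
Fixpoint ctx_comp (V : Type) (G C : ctx V) : ctx V :=
  match G with
  | Hole => C
  | CProdL G' D => CProdL (ctx_comp G' C) D
  | CProdR D G' => CProdR D (ctx_comp G' C)
  | CAndL G' D => CAndL (ctx_comp G' C) D
  | CAndR D G' => CAndR D (ctx_comp G' C)
  end.

Lemma fill_comp (V : Type) (G C : ctx V) (X : struct V) :
  fill (ctx_comp G C) X = fill G (fill C X).
Proof. induction G; simpl; congruence. Qed.

(** [repl phi D X Y]: the structure [Y] results from [X] by replacing some
    occurrences (possibly none, possibly all) of the leaf [phi] by [D]. *)
Inductive repl (V : Type) (phi : form V) (D : struct V) :
  struct V -> struct V -> Prop :=
| repl_hit : repl phi D (SForm phi) D
| repl_keep chi : repl phi D (SForm chi) (SForm chi)
| repl_prod X1 X2 Y1 Y2 :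
    repl phi D X1 Y1 -> repl phi D X2 Y2 ->
    repl phi D (SProd X1 X2) (SProd Y1 Y2)
| repl_and X1 X2 Y1 Y2 :
    repl phi D X1 Y1 -> repl phi D X2 Y2 ->
    repl phi D (SAnd X1 X2) (SAnd Y1 Y2).

Local Hint Constructors repl : core.

Lemma repl_refl (V : Type) (phi : form V) (D X : struct V) : repl phi D X X.
Proof. induction X; auto. Qed.

Local Hint Resolve repl_refl : core.

Lemma repl_fill (V : Type) (phi : form V) (D : struct V) (G : ctx V) :
  repl phi D (fill G (SForm phi)) (fill G D).
Proof. induction G; simpl; auto. Qed.

Lemma repl_mfill (V : Type) (phi : form V) (D : struct V) (G : mctx V) :
  repl phi D (mfill G (SForm phi)) (mfill G D).
Proof. induction G; simpl; auto. Qed.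

Lemma repl_form_inv (V : Type) (phi chi : form V) (D Y : struct V) :
  repl phi D (SForm chi) Y -> Y = SForm chi \/ chi = phi /\ Y = D.
Proof. intros H; inversion H; subst; auto. Qed.

Lemma repl_prod_inv (V : Type) (phi : form V) (D X1 X2 Y : struct V) :
  repl phi D (SProd X1 X2) Y ->
  exists Y1 Y2, Y = SProd Y1 Y2 /\ repl phi D X1 Y1 /\ repl phi D X2 Y2.
Proof. intros H; inversion H; subst; eauto. Qed.

Lemma repl_and_inv (V : Type) (phi : form V) (D X1 X2 Y : struct V) :
  repl phi D (SAnd X1 X2) Y ->
  exists Y1 Y2, Y = SAnd Y1 Y2 /\ repl phi D X1 Y1 /\ repl phi D X2 Y2.
Proof. intros H; inversion H; subst; eauto. Qed.

(** A replacement in [G⟦X⟧] splits into one in the context, giving [G'], and one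
    in the structure filling the hole; the former is uniform in the filler. *)
Lemma repl_fill_inv (V : Type) (phi : form V) (D : struct V) (G : ctx V) :
  forall X Y, repl phi D (fill G X) Y ->
  exists G' X', Y = fill G' X' /\ repl phi D X X' /\
    forall Z Z', repl phi D Z Z' -> repl phi D (fill G Z) (fill G' Z').
Proof.
  induction G as [|G IH E|E G IH|G IH E|E G IH]; simpl; intros X Y HR.
  - exists Hole, Y; simpl; auto.
  - destruct (repl_prod_inv HR) as (Y1 & Y2 & -> & H1 & H2).
    destruct (IH _ _ H1) as (G' & X' & -> & HX & HG).
    exists (CProdL G' Y2), X'; simpl; auto.
  - destruct (repl_prod_inv HR) as (Y1 & Y2 & -> & H1 & H2).
    destruct (IH _ _ H2) as (G' & X' & -> & HX & HG).
    exists (CProdR Y1 G'), X'; simpl; auto.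
  - destruct (repl_and_inv HR) as (Y1 & Y2 & -> & H1 & H2).
    destruct (IH _ _ H1) as (G' & X' & -> & HX & HG).
    exists (CAndL G' Y2), X'; simpl; auto.
  - destruct (repl_and_inv HR) as (Y1 & Y2 & -> & H1 & H2).
    destruct (IH _ _ H2) as (G' & X' & -> & HX & HG).
    exists (CAndR Y1 G'), X'; simpl; auto.
Qed.

(** * Permuting a cut into its left premiss *)

(** [right_intro D phi]: the consecution [D ⊢ phi] is the conclusion of a right
    rule for the main connective of [phi], or of the axiom for [Top], with
    derivable premisses. *)
Inductive right_intro (V : Type) : struct V -> form V -> Prop :=
| ri_top D : right_intro D Top
| ri_ldiv D phi psi : ⟨phi⟩ ⊙ D ⊢ psi -> right_intro D (LDiv phi psi)
| ri_rdiv D phi psi : D ⊙ ⟨psi⟩ ⊢ phi -> right_intro D (RDiv phi psi)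
| ri_prod D1 D2 phi psi :
    D1 ⊢ phi -> D2 ⊢ psi -> right_intro (SProd D1 D2) (Prod phi psi)
| ri_and D1 D2 phi psi :
    D1 ⊢ phi -> D2 ⊢ psi -> right_intro (SAnd D1 D2) (And phi psi)
| ri_or1 D phi psi : D ⊢ phi -> right_intro D (Or phi psi)
| ri_or2 D phi psi : D ⊢ psi -> right_intro D (Or phi psi).

Local Hint Constructors right_intro : core.

(** To cut [phi] it is enough to cut it when the left premiss ends with a right
    rule. *)
Lemma cut_reduction (V : Type) (G : ctx V) (gamma phi : form V) (D : struct V) :
  D ⊢ phi -> G⟦⟨phi⟩⟧ ⊢ gamma ->
  (forall E, right_intro E phi -> G⟦E⟧ ⊢ gamma) -> G⟦D⟧ ⊢ gamma.
Proof.
  intros HD; induction HD; intros Hid Hri; auto;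
    rewrite <- fill_comp.
  - apply d_bot.
  - apply d_ldivL; [assumption | rewrite fill_comp; auto].
  - apply d_rdivL; [rewrite fill_comp; auto | assumption].
  - apply d_prodL; rewrite fill_comp; auto.
  - apply d_andL; rewrite fill_comp; auto.
  - apply d_orL; rewrite fill_comp; auto.
  - apply d_contr; rewrite fill_comp; auto.
  - apply d_weak; rewrite fill_comp; auto.
  - apply d_comm; rewrite fill_comp; auto.
  - apply d_assoc; rewrite fill_comp; auto.
Qed.

(** * Permuting a mix into its right premiss *)

(** The cut rule on [phi], with a single displayed occurrence, is admissible. *)
Definition cuttable (V : Type) (phi : form V) : Prop :=
  forall (D : struct V) (G : ctx V) (gamma : form V),
    D ⊢ phi -> G⟦⟨phi⟩⟧ ⊢ gamma -> G⟦D⟧ ⊢ gamma.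

(** Cut is admissible on each immediate subformula of [phi]. *)
Definition subformulas_cuttable (V : Type) (phi : form V) : Prop :=
  match phi with
  | Var _ | Top | Bot => True
  | And a b | Or a b | LDiv a b | Prod a b | RDiv a b =>
      cuttable a /\ cuttable b
  end.

(** Cut on a formula that the left rule of its connective introduces in the
    right premiss; the premisses of that rule are given in place of its
    conclusion, while the derivation of the left premiss is arbitrary. *)
Lemma principal_ldiv (V : Type) (G : ctx V) (D E : struct V)
    (a b gamma : form V) :
  cuttable a -> cuttable b -> D ⊢ LDiv a b -> E ⊢ a -> G⟦⟨b⟩⟧ ⊢ gamma ->
  G⟦E ⊙ D⟧ ⊢ gamma.
Proof.
  intros Ha Hb HD HE HG.
  change (SProd E D) with (fill (CProdR E Hole) D); rewrite <- fill_comp.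
  apply (cut_reduction _ HD).
  - rewrite fill_comp; simpl; apply d_ldivL; assumption.
  - intros D' Hri; inversion Hri; subst.
    rewrite fill_comp; simpl; apply Hb; [|assumption].
    apply (Ha E (CProdL Hole D')); assumption.
Qed.

Lemma principal_rdiv (V : Type) (G : ctx V) (D E : struct V)
    (a b gamma : form V) :
  cuttable a -> cuttable b -> D ⊢ RDiv a b -> E ⊢ b -> G⟦⟨a⟩⟧ ⊢ gamma ->
  G⟦D ⊙ E⟧ ⊢ gamma.
Proof.
  intros Ha Hb HD HE HG.
  change (SProd D E) with (fill (CProdL Hole E) D); rewrite <- fill_comp.
  apply (cut_reduction _ HD).
  - rewrite fill_comp; simpl; apply d_rdivL; assumption.
  - intros D' Hri; inversion Hri; subst.
    rewrite fill_comp; simpl; apply Ha; [|assumption].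
    apply (Hb E (CProdR D' Hole)); assumption.
Qed.

Lemma principal_prod (V : Type) (G : ctx V) (D : struct V)
    (a b gamma : form V) :
  cuttable a -> cuttable b -> D ⊢ Prod a b -> G⟦⟨a⟩ ⊙ ⟨b⟩⟧ ⊢ gamma ->
  G⟦D⟧ ⊢ gamma.
Proof.
  intros Ha Hb HD HG; apply (cut_reduction _ HD).
  - apply d_prodL; assumption.
  - intros D' Hri; inversion Hri as [| | |D1 D2 ? ? H1 H2| | |]; subst.
    specialize (Ha D1 (ctx_comp G (CProdL Hole (SForm b))) gamma H1).
    specialize (Hb D2 (ctx_comp G (CProdR D1 Hole)) gamma H2).
    rewrite !fill_comp in Ha, Hb; auto.
Qed.

Lemma principal_and (V : Type) (G : ctx V) (D : struct V)
    (a b gamma : form V) :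
  cuttable a -> cuttable b -> D ⊢ And a b -> G⟦⟨a⟩ ⊼ ⟨b⟩⟧ ⊢ gamma ->
  G⟦D⟧ ⊢ gamma.
Proof.
  intros Ha Hb HD HG; apply (cut_reduction _ HD).
  - apply d_andL; assumption.
  - intros D' Hri; inversion Hri as [| | | |D1 D2 ? ? H1 H2| |]; subst.
    specialize (Ha D1 (ctx_comp G (CAndL Hole (SForm b))) gamma H1).
    specialize (Hb D2 (ctx_comp G (CAndR D1 Hole)) gamma H2).
    rewrite !fill_comp in Ha, Hb; auto.
Qed.

Lemma principal_or (V : Type) (G : ctx V) (D : struct V)
    (a b gamma : form V) :
  cuttable a -> cuttable b -> D ⊢ Or a b -> G⟦⟨a⟩⟧ ⊢ gamma ->
  G⟦⟨b⟩⟧ ⊢ gamma -> G⟦D⟧ ⊢ gamma.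
Proof.
  intros Ha Hb HD HGa HGb; apply (cut_reduction _ HD).
  - apply d_orL; assumption.
  - intros D' Hri; inversion Hri; subst; auto.
Qed.

Lemma bot_left (V : Type) (G : ctx V) (D : struct V) (gamma : form V) :
  D ⊢ Bot -> G⟦D⟧ ⊢ gamma.
Proof.
  intros HD; apply (cut_reduction _ HD).
  - apply d_bot.
  - intros D' Hri; inversion Hri.
Qed.

(** Mix on [phi], given cut on its immediate subformulas, by induction on the
    derivation of the right premiss.  Replacing only some of the occurrences
    lets a principal [phi] be kept or replaced independently of the others. *)
Lemma mix_step (V : Type) (phi : form V) (D X Y : struct V) (gamma : form V) :
  subformulas_cuttable phi -> D ⊢ phi -> X ⊢ gamma -> repl phi D X Y ->
  Y ⊢ gamma.
Proof.
  intros Hsub HD HX; revert Y.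
  induction HX as [chi|X|G chi|G E a b gamma HE IHE HG IHG|X a b H IH
    |G E a b gamma HG IHG HE IHE|X a b H IH|G a b gamma H IH
    |X1 X2 a b H1 IH1 H2 IH2|G a b gamma H IH|X1 X2 a b H1 IH1 H2 IH2
    |G a b gamma Ha IHa Hb IHb|X a b H IH|X a b H IH
    |G E gamma H IH|G S E gamma H IH|G E L gamma H IH|G E1 E2 E3 gamma H IH];
    intros Y HR;
    (* Split the replacement of a left or structural rule along its context. *)
    try (destruct (repl_fill_inv _ _ HR) as (G' & X' & -> & HX' & HG')).
  - destruct (repl_form_inv HR) as [-> | [-> ->]]; [apply d_id | exact HD].
  - apply d_top.
  - destruct (repl_form_inv HX') as [-> | [<- ->]].
    + apply d_bot.
    + apply bot_left; assumption.
  - destruct (repl_prod_inv HX') as (E' & F & -> & H1 & H2).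
    destruct (repl_form_inv H2) as [-> | [<- ->]].
    + apply d_ldivL; auto.
    + destruct Hsub as [Hca Hcb]; apply (principal_ldiv _ Hca Hcb HD); auto.
  - apply d_ldivR; auto.
  - destruct (repl_prod_inv HX') as (F & E' & -> & H1 & H2).
    destruct (repl_form_inv H1) as [-> | [<- ->]].
    + apply d_rdivL; auto.
    + destruct Hsub as [Hca Hcb]; apply (principal_rdiv _ Hca Hcb HD); auto.
  - apply d_rdivR; auto.
  - destruct (repl_form_inv HX') as [-> | [<- ->]].
    + apply d_prodL; auto.
    + destruct Hsub as [Hca Hcb]; apply (principal_prod _ Hca Hcb HD); auto.
  - destruct (repl_prod_inv HR) as (Y1 & Y2 & -> & ? & ?).
    apply d_prodR; auto.
  - destruct (repl_form_inv HX') as [-> | [<- ->]].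
    + apply d_andL; auto.
    + destruct Hsub as [Hca Hcb]; apply (principal_and _ Hca Hcb HD); auto.
  - destruct (repl_and_inv HR) as (Y1 & Y2 & -> & ? & ?).
    apply d_andR; auto.
  - destruct (repl_form_inv HX') as [-> | [<- ->]].
    + apply d_orL; auto.
    + destruct Hsub as [Hca Hcb]; apply (principal_or _ Hca Hcb HD); auto.
  - apply d_orR1; auto.
  - apply d_orR2; auto.
  - apply d_contr; auto.
  - destruct (repl_and_inv HX') as (Y1 & Y2 & -> & ? & ?).
    apply d_weak; auto.
  - destruct (repl_and_inv HX') as (Y1 & Y2 & -> & ? & ?).
    apply d_comm; auto.
  - destruct (repl_and_inv HX') as (Y1 & Y' & -> & ? & HY').
    destruct (repl_and_inv HY') as (Y2 & Y3 & -> & ? & ?).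
    apply d_assoc; auto.
Qed.

(** * Admissibility of mix *)

Lemma cuttable_all (V : Type) (phi : form V) : cuttable phi.
Proof.
  assert (Hstep : forall chi : form V, subformulas_cuttable chi -> cuttable chi)
    by (intros chi Hsub D G gamma HD HG;
        exact (mix_step Hsub HD HG (repl_fill chi D G))).
  induction phi; apply Hstep; simpl; auto.
Qed.

Theorem theorem10 (V : Type) (G : mctx V) (D : struct V) (phi psi : form V)
    (hG : 1 <= holes G) :
  derivable D phi -> derivable (mfill G (SForm phi)) psi ->
  derivable (mfill G D) psi.
Proof.
  intros HD HG.
  assert (Hsub : subformulas_cuttable phi)
    by (destruct phi; simpl; auto using cuttable_all).
  exact (mix_step Hsub HD HG (repl_mfill phi D G)).
Qed.
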